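(* Let $E=(E^0,E^1,r,s)$ be a directed graph, and let $\{F_1,F_2\}$ be an admissible decomposition of $E$. Then: (1) $\partial E=\partial F_1\cup\partial F_2$ (where $E=F_1\cup F_2$); (2) $\partial(F_1\cap F_2)=\partial F_1\cap\partial F_2$.
   Context: A directed graph $E=(E^0,E^1,r,s)$ has vertex set $E^0$, edge set $E^1$ and range and source maps $r,s:E^1\to E^0$. For a graph $E$, $\operatorname{sink}(E)=\{v: s^{-1}(v)=\emptyset\}$, $\operatorname{reg}(E)=\{v\in E^0:0<|s^{-1}(v)|<\infty\}$ and $\operatorname{sing}(E)=E^0\setminus\operatorname{reg}(E)$. A finite path of length $n\ge1$ is a sequence $e_1\cdots e_n$ of edges with $r(e_i)=s(e_{i+1})$, and its range is $r(e_n)$; vertices are the paths of length $0$, with $r(v)=v$. $E^*$ is the set of all finite paths and $E^\infty$ the set of infinite paths $e_1e_2\cdots$ with $r(e_i)=s(e_{i+1})$ for all $i$. The boundary path space is $$\partial E=E^\infty\sqcup\{u\in E^*: r(u)\in\operatorname{sing}(E)\}.$$ A subgraph $F$ of $E$ consists of subsets $F^0\subseteq E^0$, $F^1\subseteq E^1$ with range and source maps $r_F,s_F$ the restrictions of $r,s$; unions and intersections of subgraphs are taken on vertices and edges. Paths in a subgraph are regarded as paths in $E$; $\operatorname{sink}$, $\operatorname{reg}$, $\operatorname{sing}$ and $\partial$ of a subgraph are computed within that subgraph. A pair $\{F_1,F_2\}$ of subgraphs of $E$ is an admissible decomposition of $E$ if: (a) $E=F_1\cup F_2$; (b) $\operatorname{sink}(F_1\cap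 F_2)\subseteq\operatorname{sing}(F_1)\cap\operatorname{sing}(F_2)$; (c) $F_1^1\cap F_2^1=r_{F_1}^{-1}(F_1^0\cap F_2^0)=r_{F_2}^{-1}(F_1^0\cap F_2^0)$; (d) $\operatorname{sing}(F_1)\cap\operatorname{reg}(F_1\cap F_2)\subseteq\operatorname{reg}(F_2)$. *)

(* Defs.v *)
From mathcomp Require Import all_boot.
From mathcomp Require Import boolp classical_sets functions cardinality.

Set Implicit Arguments.
Unset Strict Implicit.
Unset Printing Implicit Defensive.

Local Open Scope classical_set_scope.

Record digraph := Digraph {
  vertex : Type;
  edge : Type;
  rng : edge -> vertex;
  src : edge -> vertex
}.

Record subgraph (E : digraph) := Subgraph {
  vset : set (vertex E);
  eset : set (edge E);
  rng_vset : forall e : edge E, eset e -> vset (rng e);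
  src_vset : forall e : edge E, eset e -> vset (src e)
}.

(* E as a subgraph of itself; [sink], [reg], [sing] and [boundary] below are
   defined for subgraphs, and those of E are those of [whole E]. *)
Definition whole (E : digraph) : subgraph E :=
  @Subgraph E setT setT (fun _ _ => I) (fun _ _ => I).

Section SubgraphOperations.
Variables (E : digraph) (F1 F2 : subgraph E).

Lemma subgraphU_rng (e : edge E) :
  (eset F1 `|` eset F2) e -> (vset F1 `|` vset F2) (rng e).
Proof. by case=> /rng_vset; [left | right]. Qed.

Lemma subgraphU_src (e : edge E) :
  (eset F1 `|` eset F2) e -> (vset F1 `|` vset F2) (src e).
Proof. by case=> /src_vset; [left | right]. Qed.

Definition subgraphU : subgraph E :=
  @Subgraph E (vset F1 `|` vset F2) (eset F1 `|` eset F2)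
    subgraphU_rng subgraphU_src.

Lemma subgraphI_rng (e : edge E) :
  (eset F1 `&` eset F2) e -> (vset F1 `&` vset F2) (rng e).
Proof. by case=> /rng_vset ? /rng_vset. Qed.

Lemma subgraphI_src (e : edge E) :
  (eset F1 `&` eset F2) e -> (vset F1 `&` vset F2) (src e).
Proof. by case=> /src_vset ? /src_vset. Qed.

Definition subgraphI : subgraph E :=
  @Subgraph E (vset F1 `&` vset F2) (eset F1 `&` eset F2)
    subgraphI_rng subgraphI_src.

End SubgraphOperations.

Section Subgraph.
Variables (E : digraph) (F : subgraph E).

Definition src_preim (v : vertex E) : set (edge E) :=
  [set e | eset F e /\ src e = v].

Definition rng_preim (A : set (vertex E)) : set (edge E) :=
  [set e | eset F e /\ A (rng e)].

Definition sink : set (vertex E) :=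
  [set v | vset F v /\ src_preim v = set0].

Definition reg : set (vertex E) :=
  [set v | [/\ vset F v, src_preim v !=set0 & finite_set (src_preim v)]].

Definition sing : set (vertex E) := vset F `\` reg.

End Subgraph.

(* Raw finite and infinite words; being a path of a given subgraph is imposed
   by [fin_paths] and [inf_paths]. The three constructors keep the paths of
   length 0, of length n >= 1 and of infinite length disjoint, and
   [EdgeWord e w] is the word e w of length 1 + size w. *)
Inductive word (E : digraph) : Type :=
| VertexWord of vertex E
| EdgeWord of edge E & seq (edge E)
| InfWord of (nat -> edge E).

Fixpoint chain (E : digraph) (F : subgraph E) (e : edge E)
    (w : seq (edge E)) : Prop :=
  eset F e /\
  (if w is e' :: w' then rng e = src e' /\ chain F e' w' else True).

Section Paths.
Variables (E : digraph) (F : subgraph E).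

Definition fin_paths : set (word E) :=
  [set u | match u with
           | VertexWord v => vset F v
           | EdgeWord e w => chain F e w
           | InfWord _ => False
           end].

Definition inf_paths : set (word E) :=
  [set u | match u with
           | InfWord x =>
               forall n, eset F (x n) /\ rng (x n) = src (x n.+1)
           | _ => False
           end].

(* The condition that the range of u lies in A; infinite words have none. *)
Definition range_in (A : set (vertex E)) (u : word E) : Prop :=
  match u with
  | VertexWord v => A v
  | EdgeWord e w => A (rng (last e w))
  | InfWord _ => False
  end.

Definition boundary : set (word E) :=
  inf_paths `|` [set u | fin_paths u /\ range_in (sing F) u].

End Paths.

Record admissible (E : digraph) (F1 F2 : subgraph E) : Prop := Admissible {
  admissible_cover : whole E = subgraphU F1 F2;
  admissible_sink : sink (subgraphI F1 F2) `<=` sing F1 `&` sing F2;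
  admissible_rng1 :
    eset F1 `&` eset F2 = rng_preim F1 (vset F1 `&` vset F2);
  admissible_rng2 :
    eset F1 `&` eset F2 = rng_preim F2 (vset F1 `&` vset F2);
  admissible_reg : sing F1 `&` reg (subgraphI F1 F2) `<=` reg F2
}.

(* Main.v *)
(* Together, (a) and (c) say that each F_i contains every edge of E whose range
   lies in F_i. Reading a path backwards from its range, the paths of F_i are
   thus exactly the paths of E with range in F_i, and an infinite path leaves
   F_i for good as soon as it leaves it. It then suffices to see that
   sing E = sing F1 U sing F2, by (b), and that
   sing (F1 n F2) = sing F1 n sing F2, by (b) and (d). *)
Require Import Defs.
From mathcomp Require Import all_boot.
From mathcomp Require Import boolp classical_sets functions cardinality.

Set Implicit Arguments.
Unset Strict Implicit.

Local Open Scope classical_set_scope.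

Section RangeClosed.
Variables (E : digraph) (F : subgraph E).

Definition range_closed : Prop := forall e, vset F (rng e) -> eset F e.

Lemma chain_whole e w : chain F e w -> chain (whole E) e w.
Proof. by elim: w e => [|e' w IH] e //= [_ [re /IH]]. Qed.

Lemma chain_last e w : chain F e w -> eset F (last e w).
Proof. by elim: w e => [|e' w IH] e /= [] // _ [_ /IH]. Qed.

Lemma chain_src e w : chain F e w -> vset F (src e).
Proof. by case: w => [|e' w] [/src_vset]. Qed.

Hypothesis clF : range_closed.

(** By induction the tail lies in [F]; the source of its first edge is the range of [e], so closure
    puts [e] in [F] as well. *)
Lemma chain_range_closed e w :
  chain (whole E) e w -> vset F (rng (last e w)) -> chain F e w.
Proof.
elim: w e => [|e' w IH] e /= [_]; first by move=> _ /clF.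
move=> [re ch] lw; have chF := IH _ ch lw.
by split=> //; apply: clF; rewrite re; apply: chain_src chF.
Qed.

Lemma fin_paths_range_closed u :
  fin_paths F u <-> fin_paths (whole E) u /\ range_in (vset F) u.
Proof.
case: u => [v|e w|x] /=; [by split=> // -[] | | by split=> // -[]].
split=> [ch|[ch lw]]; last exact: chain_range_closed.
by split; [exact: chain_whole ch | exact/rng_vset/chain_last].
Qed.

(** The source of each edge is the range of the one before, so membership in [F] passes backwards
    from [n] to [m], one edge at a time. *)
Lemma inf_path_prefix x m n : inf_paths (whole E) (InfWord x) ->
  m <= n -> eset F (x n) -> eset F (x m).
Proof.
move=> xE /subnK <-; elim: (n - m) => [//|k IH] /src_vset.
by have [_ <-] := xE (k + m) => /clF.
Qed.

End RangeClosed.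

Lemma range_in_mono (E : digraph) (A B : set (vertex E)) (u : word E) :
  A `<=` B -> range_in A u -> range_in B u.
Proof. by case: u => [v|e w|x] //= AB /AB. Qed.

Lemma range_inU (E : digraph) (A B : set (vertex E)) (u : word E) :
  range_in (A `|` B) u <-> range_in A u \/ range_in B u.
Proof. by case: u => [v|e w|x] //=; split=> // -[]. Qed.

Lemma range_inI (E : digraph) (A B : set (vertex E)) (u : word E) :
  range_in (A `&` B) u <-> range_in A u /\ range_in B u.
Proof. by case: u => [v|e w|x] //=; split=> // -[]. Qed.

Lemma sing_vset (E : digraph) (F : subgraph E) : sing F `<=` vset F.
Proof. by move=> v []. Qed.

(** Splits failure of regularity into sinks and infinite emitters, the two cases of
    [sing_cover_sub], [sing_whole_sub] and [sing_subgraphI_sub]. *)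
Lemma singP (E : digraph) (F : subgraph E) (v : vertex E) :
  sing F v <-> vset F v /\ (src_preim F v = set0 \/ infinite_set (src_preim F v)).
Proof.
split=> [[vF nreg]|[vF emits]]; split=> //.
  have [->|/set0P ne0] := eqVneq (src_preim F v) set0; first by left.
  by right=> fin; apply: nreg.
case=> _ [e ev] fin; case: emits => [ev0|//].
by rewrite ev0 in ev.
Qed.

Lemma fin_paths_subgraphI (E : digraph) (F1 F2 : subgraph E) (u : word E) :
  fin_paths (subgraphI F1 F2) u <-> fin_paths F1 u /\ fin_paths F2 u.
Proof.
case: u => [v|e w|x] //=; last by split=> // -[].
elim: w e => [|e' w IH] e /=.
  by split=> [[[? ?] _]|[[? _] [? _]]].
by split=> [[[? ?] [? /IH[]]]|[[? [? ?]] [? [_ ?]]]] //; do ?split=> //; apply/IH.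
Qed.

Section Cover.
Variables (E : digraph) (F1 F2 : subgraph E).
Hypothesis cover : whole E = subgraphU F1 F2.

Lemma cover_vset v : vset F1 v \/ vset F2 v.
Proof. by have: vset (whole E) v by []; rewrite cover. Qed.

Lemma cover_eset e : eset F1 e \/ eset F2 e.
Proof. by have: eset (whole E) e by []; rewrite cover. Qed.

Lemma cover_src_preim v :
  src_preim (whole E) v = src_preim F1 v `|` src_preim F2 v.
Proof.
apply/seteqP; split=> e; last by case=> -[].
by move=> [_ ev]; case: (cover_eset e) => ?; [left|right].
Qed.

(** Crosswise: an edge outside [F1] lies in [F2], so if its range is in [F1] it is in both vertex
    sets, and (c) for [F2] puts the edge in [F1]. *)
Lemma range_closed_cover :
  eset F1 `&` eset F2 = rng_preim F2 (vset F1 `&` vset F2) -> range_closed F1.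
Proof.
move=> c e re; case: (cover_eset e) => // eF2.
suff: (eset F1 `&` eset F2) e by case.
by rewrite c; split=> //; split=> //; exact: rng_vset.
Qed.

(** Infinite emitters of [F1] remain so in [E]. A sink of [F1] that emits in [F2] is a sink of the
    intersection, hence singular in [F2], and all edges it emits in [E] belong to [F2]. *)
Lemma sing_cover_sub :
  sink (subgraphI F1 F2) `<=` sing F2 -> sing F1 `<=` sing (whole E).
Proof.
move=> sinkF v /singP[vF1 emits]; apply/singP; split=> //.
rewrite cover_src_preim; case: emits => [F1v0|inf]; last first.
  by right; apply: contra_not inf; apply: sub_finite_set; exact: subsetUl.
rewrite F1v0 set0U.
have [->|/set0P[e [eF2 ev]]] := eqVneq (src_preim F2 v) set0; first by left.
have vF2 : vset F2 v by rewrite -ev; exact: src_vset.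
suff /sinkF/singP[] : sink (subgraphI F1 F2) v by [].
split=> //; apply/seteqP; split=> // f [[fF1 _] fv].
by rewrite -F1v0.
Qed.

Lemma sing_whole_sub : sing (whole E) `<=` sing F1 `|` sing F2.
Proof.
move=> v /singP[_]; rewrite cover_src_preim => -[|inf].
  rewrite setU_eq0 => -[F1v0 F2v0].
  by case: (cover_vset v) => ?; [left|right]; apply/singP; split=> //; left.
(* Any one of the infinitely many edges already shows that [v] is a vertex of [F]. *)
have inf_sing (F : subgraph E) : infinite_set (src_preim F v) -> sing F v.
  move=> infF; apply/singP; split; last by right.
  by have /infinite_setN0 [e [eF <-]] := infF; exact: src_vset.
have [fin1|] := pselect (finite_set (src_preim F1 v)); last by move/inf_sing; left.
right; apply: inf_sing => fin2; apply: inf.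
by rewrite finite_setU.
Qed.

End Cover.

(** Sinks fall under the hypothesis; an infinite emitter of the intersection emits at least these
    edges in [F1] and in [F2]. *)
Lemma sing_subgraphI_sub (E : digraph) (F1 F2 : subgraph E) :
  sink (subgraphI F1 F2) `<=` sing F1 `&` sing F2 ->
  sing (subgraphI F1 F2) `<=` sing F1 `&` sing F2.
Proof.
move=> sinkF v /singP[[vF1 vF2] [Iv0|inf]]; first exact: sinkF.
by split; apply/singP; split=> //; right; apply: contra_not inf;
  apply: sub_finite_set => e [[]].
Qed.

Lemma subgraphUC (E : digraph) (F1 F2 : subgraph E) :
  subgraphU F1 F2 = subgraphU F2 F1.
Proof.
(* The types of the proof fields mention the sets, so these fields are generalized before the sets
   are rewritten. *)
rewrite /subgraphU; move: (@subgraphU_rng E F1 F2) (@subgraphU_src E F1 F2).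
by rewrite (setUC (vset F1)) (setUC (eset F1)) => r s; f_equal; exact: Prop_irrelevance.
Qed.

Lemma subgraphIC (E : digraph) (F1 F2 : subgraph E) :
  subgraphI F1 F2 = subgraphI F2 F1.
Proof.
rewrite /subgraphI; move: (@subgraphI_rng E F1 F2) (@subgraphI_src E F1 F2).
by rewrite (setIC (vset F1)) (setIC (eset F1)) => r s; f_equal; exact: Prop_irrelevance.
Qed.

Section Admissible.
Variables (E : digraph) (F1 F2 : subgraph E).
Hypothesis hF : admissible F1 F2.

Let cover := admissible_cover hF.

Let cover' : whole E = subgraphU F2 F1.
Proof. by rewrite subgraphUC. Qed.

Lemma admissible_range_closed1 : range_closed F1.
Proof. exact: range_closed_cover cover (admissible_rng2 hF). Qed.

Lemma admissible_range_closed2 : range_closed F2.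
Proof.
apply: range_closed_cover cover' _.
by rewrite setIC (setIC (vset F2)); exact: admissible_rng1 hF.
Qed.

Lemma sing_whole_admissible : sing (whole E) = sing F1 `|` sing F2.
Proof.
apply/seteqP; split; first exact: sing_whole_sub.
move=> v [|].
  by apply: (sing_cover_sub cover) => w /(admissible_sink hF)[].
apply: (sing_cover_sub cover') => w.
by rewrite subgraphIC => /(admissible_sink hF)[].
Qed.

Lemma sing_subgraphI_admissible : sing (subgraphI F1 F2) = sing F1 `&` sing F2.
Proof.
apply/seteqP; split; first exact/sing_subgraphI_sub/(admissible_sink hF).
move=> v [sF1 [vF2 nreg2]]; split; first by split=> //; case: sF1.
(* If [v] were regular in the intersection, (d) would make it regular in [F2]. *)
by move=> regI; apply: nreg2; apply: (admissible_reg hF).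
Qed.

(** Moves finite boundary paths into [E], so that only the range conditions differ between
    subgraphs. *)
Lemma fin_paths_sing (F : subgraph E) (u : word E) : range_closed F ->
  (fin_paths F u /\ range_in (sing F) u) <->
  (fin_paths (whole E) u /\ range_in (sing F) u).
Proof.
move=> clF; split=> -[pu su]; split=> //.
  by have /(fin_paths_range_closed clF)[] := pu.
apply/(fin_paths_range_closed clF); split=> //.
by apply: range_in_mono su; exact: sing_vset.
Qed.

Lemma inf_paths_admissible :
  inf_paths (whole E) = inf_paths F1 `|` inf_paths F2.
Proof.
apply/seteqP; split=> -[v|e w|x] //=; last first.
- by move=> [] xF n; have [] := xF n.
- by case.
- by case.
move=> xE; have [all1|] := pselect (forall n, eset F1 (x n)).
  by left=> n; split=> //; have [] := xE n.
move=> /existsNP[n nF1]; right=> m; split; last by have [] := xE m.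
(* The edge at [maxn n m] is not in [F1], or else [x n] would be; so it is in [F2], and with it the
   earlier edge [x m]. *)
have cl2 := admissible_range_closed2.
apply: (inf_path_prefix cl2 xE (leq_maxr n m)).
case: (cover_eset cover (x (maxn n m))) => // /(inf_path_prefix
  admissible_range_closed1 xE (leq_maxl n m)).
by move/nF1.
Qed.

Lemma inf_paths_subgraphI :
  inf_paths (subgraphI F1 F2) = inf_paths F1 `&` inf_paths F2.
Proof.
apply/seteqP; split=> -[v|e w|x] //=; try by case.
  by move=> xI; split=> n; have [[]] := xI n.
by move=> [x1 x2] n; have [? ?] := x1 n; have [] := x2 n.
Qed.

End Admissible.

Unset Implicit Arguments.

Theorem proposition4p3 (E : digraph) (F1 F2 : subgraph E)
    (hF : admissible F1 F2) :
  boundary (whole E) = boundary F1 `|` boundary F2 /\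
  boundary (subgraphI F1 F2) = boundary F1 `&` boundary F2.
Proof.
have cl1 := admissible_range_closed1 hF.
have cl2 := admissible_range_closed2 hF.
split; rewrite /boundary.
  rewrite (inf_paths_admissible hF) setUACA; congr (_ `|` _).
  apply/seteqP; split=> u /=; rewrite (sing_whole_admissible hF).
    by move=> [pu /range_inU[]]; [left|right]; apply/fin_paths_sing.
  by move=> [] /fin_paths_sing[] // pu su; split=> //; apply/range_inU; [left|right].
rewrite inf_paths_subgraphI; apply/seteqP; split=> u /=.
  move=> [[]|[/fin_paths_subgraphI[p1 p2]]]; first by split; left.
  by rewrite (sing_subgraphI_admissible hF) => /range_inI[]; split; right.
move=> [[x1|[p1 s1]] [x2|[p2 s2]]].
- by left.
(* In the two mixed cases [u] would be both an infinite and a finite word. *)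
- by case: u x1 p2 {s2}.
- by case: u p1 x2 {s1}.
right; split; first exact/fin_paths_subgraphI.
by rewrite (sing_subgraphI_admissible hF); apply/range_inI.
Qed.
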